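(* Let $E$ be a nonzero real reflexive Banach space with dual $E^*$, let $J\colon E \rightrightarrows E^*$ be the duality map, and let $S\colon E \rightrightarrows E^*$ be a closed and monotone multifunction with nonempty graph. Then $S$ is quasidense if, and only if, for all $x \in E$, the multifunction ${}_xS + J\colon E \rightrightarrows E^*$ is surjective.
   Context: $\langle\cdot,\cdot\rangle\colon E \times E^* \to \mathbb{R}$ is the duality pairing. A multifunction $S\colon E \rightrightarrows E^*$ assigns to each $x\in E$ a (possibly empty) subset $S(x)$ of $E^*$; its graph is $G(S) = \{(x,x^* ) \in E\times E^* : x^* \in S(x)\}$. $S$ is closed if $G(S)$ is a (norm-)closed subset of $E \times E^*$, and monotone if $\langle s - t, s^* - t^*\rangle \ge 0$ for all $(s,s^* ),(t,t^* ) \in G(S)$. For $x \in E$, the multifunction ${}_xS\colon E \rightrightarrows E^*$ is defined by ${}_xS(t) = S(t+x)$ for all $t \in E$. The sum of multifunctions is pointwise: $(S+T)(t) = \{s^*+t^* : s^*\in S(t),\ t^* \in T(t)\}$. A multifunction $T\colon E\rightrightarrows E^*$ is surjective if $\bigcup_{t\in E} T(t) = E^*$. The duality map $J$ is given by: $x^* \in Jx$ if and only if $\frac12\|x\|^2 + \frac12\|x^*\|^2 = \langle x, x^*\rangle$ (equivalently $\|x\|^2 = \|x^*\|^2 = \langle x,x^*\rangle$). $S$ is called quasidense if, for all $(x,x^* ) \in E \times E^*$, $$\inf_{(s,s^* ) \in G(S)}\left[\tfrac12\|s - x\|^2 + \tfrac12\|s^* - x^*\|^2 + \langle s - x, s^*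 - x^*\rangle\right] \le 0.$$ *)

(* Defs.v *)
From HB Require Import structures.
From mathcomp Require Import all_boot all_order all_algebra.
From mathcomp Require Import all_classical all_reals.
From mathcomp Require Import ereal topology normedtype.

Set Implicit Arguments.
Unset Strict Implicit.
Unset Printing Implicit Defensive.

Import Order.TTheory GRing.Theory Num.Theory.
Import numFieldNormedType.Exports.

Local Open Scope classical_set_scope.
Local Open Scope ring_scope.

Section ContinuousLinear.
Context {R : realType} (E : normedModType R).

Definition continuous_linear : {pred (E -> R^o)} :=
  mem [set f : E -> R^o | linear f /\ continuous f].

Lemma continuous_linear_submod_closed : submod_closed continuous_linear.
Proof.
split=> [|a f g]; rewrite !inE.
  split; first by move=> a x y /=; rewrite scaler0 addr0.
  exact: (@cst_continuous E R^o 0).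
move=> -[fl fc] [gl gc]; split=> [b x y|x].
  rewrite !fctE /= fl gl !scalerDr !scalerA [a * b]mulrC.
  by rewrite -!addrA; congr (_ + _); rewrite addrCA.
by apply: cvgD; [apply: cvgZl_tmp; exact: fc | exact: gc].
Qed.

HB.instance Definition _ := GRing.isSubmodClosed.Build R _ continuous_linear
  continuous_linear_submod_closed.

Record dual := Dual {
  dual_fun :> E -> R^o ;
  dual_funP : dual_fun \in continuous_linear }.

HB.instance Definition _ := [isSub for dual_fun].
HB.instance Definition _ := [Choice of dual by <:].
HB.instance Definition _ := [SubChoice_isSubLmodule of dual by <:].

End ContinuousLinear.

Section DualNorm.
Context {R : realType} {E : normedModType R}.
Implicit Types (f g : dual E) (x : E).

Let dual_linear f : linear f.
Proof. by case: f => f fP /=; move: fP; rewrite inE => -[]. Qed.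

HB.instance Definition _ f :=
  GRing.isLinear.Build R E R^o *:%R (dual_fun f) (@dual_linear f).

Lemma dual_continuous f : continuous f.
Proof. by case: f => f fP /=; move: fP; rewrite inE => -[]. Qed.

Lemma dualP f g : f =1 g -> f = g.
Proof. by move=> fg; apply/val_inj/funext. Qed.

Lemma dualDE f g x : (f + g) x = f x + g x. Proof. by []. Qed.

Lemma dualZE a f x : (a *: f) x = a * f x. Proof. by []. Qed.

Lemma dual0E x : (0 : dual E) x = 0. Proof. by []. Qed.

Definition dual_norm f : R :=
  sup [set `|f x| | x in [set x : E | `|x| <= 1]].

Let dual_norm_has_sup f :
  has_sup [set `|f x| | x in [set x : E | `|x| <= 1]].
Proof.
split; first by exists `|f 0|; exists 0 => //=; rewrite normr0 ler01.
have /(_ 0) /continuous_linear_bounded : continuous f := @dual_continuous f.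
move=> /(_ 0) /bounded_funP /(_ 1) [M fM].
by exists M => _ [x x1 <-]; exact: fM.
Qed.

Lemma dual_norm_ge f x : `|x| <= 1 -> `|f x| <= dual_norm f.
Proof.
by move=> x1; apply: (sup_upper_bound (dual_norm_has_sup f)); exists x.
Qed.

Lemma dual_norm_le f (M : R) :
  (forall x, `|x| <= 1 -> `|f x| <= M) -> dual_norm f <= M.
Proof.
move=> fM; apply: ge_sup; first by case: (dual_norm_has_sup f).
by move=> _ [x x1 <-]; exact: fM.
Qed.

Lemma dual_norm_bound f x : `|f x| <= dual_norm f * `|x|.
Proof.
have [->|x0] := eqVneq x 0; first by rewrite linear0 !normr0 mulr0.
have nx : 0 < `|x| by rewrite normr_gt0.
rewrite -ler_pdivrMr//.
have := @dual_norm_ge f (`|x|^-1 *: x).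
rewrite linearZ /= !normrZ normfV normr_id mulVf ?gt_eqF// => /(_ (lexx _)).
by rewrite mulrC.
Qed.

Let dual_ler_normD f g : dual_norm (f + g) <= dual_norm f + dual_norm g.
Proof.
apply: dual_norm_le => x x1; rewrite dualDE.
by rewrite (le_trans (ler_normD _ _))// lerD// dual_norm_ge.
Qed.

Let dual_normrZ (a : R) f : dual_norm (a *: f) = `|a| * dual_norm f.
Proof.
have le_normZ b h : dual_norm (b *: h) <= `|b| * dual_norm h.
  apply: dual_norm_le => x x1; rewrite dualZE normrM.
  by rewrite ler_wpM2l// dual_norm_ge.
apply/eqP; rewrite eq_le le_normZ /=.
have [->|a0] := eqVneq a 0.
  rewrite normr0 mul0r (le_trans _ (@dual_norm_ge _ 0 _))//.
  by rewrite normr0 ler01.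
rewrite -ler_pdivlMl ?normr_gt0// -normfV.
by rewrite -[in leLHS](scalerK a0 f) le_normZ.
Qed.

Let dual_normr0_eq0 f : dual_norm f = 0 -> f = 0.
Proof.
move=> f0; apply: dualP => x; apply/eqP; rewrite dual0E -normr_le0.
by rewrite (le_trans (dual_norm_bound f x))// f0 mul0r.
Qed.

HB.instance Definition _ := Lmodule_isNormed.Build R (dual E)
  dual_ler_normD dual_normrZ dual_normr0_eq0.

Lemma dual_normE f : `|f| = dual_norm f. Proof. by []. Qed.

End DualNorm.

Section Duality.
Context {R : realType} {E : normedModType R}.

Definition pairing (x : E) (f : dual E) : R := f x.

Lemma bidual_embedding_subproof (x : E) :
  (pairing x : dual E -> R^o) \in @continuous_linear R (dual E).
Proof.
rewrite inE; split=> [//|].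
pose l : {linear dual E -> R^o} := HB.pack (pairing x : dual E -> R^o)
  (GRing.isLinear.Build R (dual E) R^o *:%R (pairing x) (fun _ _ _ => erefl)).
apply: (@bounded_linear_continuous R _ _ l); apply/linear_boundedP.
near=> r => f; apply: (le_trans (dual_norm_bound f x)).
by rewrite -dual_normE mulrC ler_wpM2r.
Unshelve. all: by end_near. Qed.

Definition bidual_embedding (x : E) : dual (dual E) :=
  Dual (bidual_embedding_subproof x).

Definition reflexive_space := range bidual_embedding = [set: dual (dual E)].

End Duality.
Arguments reflexive_space {R} E.

Section Multifunctions.
Context {R : realType} {E : normedModType R}.

Definition multifunction := E -> set (dual E).

Implicit Types S T : multifunction.

Definition graph S : set (E * dual E) := [set p | S p.1 p.2].

Definition closed_multi S := closed (graph S).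

Definition monotone_multi S := forall p q, graph S p -> graph S q ->
  0 <= pairing (p.1 - q.1) (p.2 - q.2).

Definition translate (x : E) S : multifunction := fun t => S (t + x).

Definition add_multi S T : multifunction :=
  fun t => [set f + g | f in S t & g in T t].

Definition surjective_multi T := \bigcup_(t in [set: E]) T t = [set: dual E].

Definition duality_map : multifunction := fun x =>
  [set f | 2^-1 * `|x| ^+ 2 + 2^-1 * `|f| ^+ 2 = pairing x f].

(* The infimum is taken in the extended reals, so that it is +oo when the
   graph is empty. *)
Definition quasidense S := forall (x : E) (f : dual E),
  (ereal_inf [set (2^-1 * `|p.1 - x| ^+ 2 + 2^-1 * `|p.2 - f| ^+ 2
                   + pairing (p.1 - x) (p.2 - f))%:E | p in graph S] <= 0)%E.

End Multifunctions.
Arguments multifunction {R} E.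
Arguments duality_map {R} E.

(* Main.v *)
Require Import Defs.
From HB Require Import structures.
From mathcomp Require Import all_boot all_order all_algebra.
From mathcomp Require Import all_classical all_reals.
From mathcomp Require Import ereal topology normedtype.
From mathcomp Require Import ring lra.

(** Write gap u w = |u|^2 / 2 + |w|^2 / 2 + <u, w>.  It is nonnegative, and it
vanishes exactly when - w belongs to J u.  Hence f lies in the range of the
translate of S by x plus J if, and only if, some (s, s') in the graph of S has
gap (s - x) (s' - f) = 0, whereas quasidensity says that these gaps have
infimum at most 0.  Surjectivity thus gives quasidensity at once, and the
theorem amounts to the attainment of an infimum ([quasidense_gap0]).

Attainment goes through weak limits.  Monotonicity bounds the almost
minimizers ([almost_minimizer_bounded]), so that along an ultrafilter of almost
minimizers the differences (s - x, s' - f) converge: their second components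
converge pointwise to some b in the dual, their first components weakly to some
a, by reflexivity.  The pairing of two weakly convergent families need not
converge to the pairing of the limits, but here its limit is known: the gaps
tend to 0, so it is minus the limit of the half squared norms, which by weak
lower semicontinuity is at most -(|a|^2 + |b|^2) / 2.  Passing to the limit in
the monotonicity inequality against a fixed point (t, t') of the graph gives

  gap a b <= < a + x - t, b + f - t' >.

The left side is nonnegative, so (a + x, b + f) is monotonically related to
the graph.  A closed quasidense multifunction contains each such point
([quasidense_maximal]), so (t, t') = (a + x, b + f) is allowed above and
gap a b = 0.

Weak lower semicontinuity of the norm rests on norming functionals, hence on
the Hahn-Banach theorem.  It is obtained from the fact that a minimal sublinear
functional is linear ([minimal_sublinear_linear]), which keeps Zorn's lemma to
functionals defined on the whole space. *)

Set Implicit Arguments.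
Unset Strict Implicit.
Unset Printing Implicit Defensive.

Import Order.TTheory GRing.Theory Num.Theory.
Import numFieldNormedType.Exports.

Local Open Scope classical_set_scope.
Local Open Scope ring_scope.

(** * Norming functionals *)

Section Sublinear.
Context {R : realType} {E : lmodType R}.
Implicit Types (p q : E -> R) (x y v : E).

Definition sublinear p :=
  (forall x y, p (x + y) <= p x + p y) /\
  (forall (a : R) x, 0 <= a -> p (a *: x) <= a * p x).

Lemma sublinear_scale p (a : R) x :
  sublinear p -> 0 <= a -> p (a *: x) = a * p x.
Proof.
move=> [pD pZ] a0; apply/eqP; rewrite eq_le pZ//=.
have [a_eq0|a_neq0] := eqVneq a 0; last first.
  have := pZ a^-1 (a *: x); rewrite invr_ge0 scalerA mulVf// scale1r => /(_ a0).
  by rewrite ler_pdivlMl// lt_def a_neq0.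
by have := pD 0 0; rewrite a_eq0 scale0r mul0r addr0; lra.
Qed.

Lemma sublinear0 p : sublinear p -> p 0 = 0.
Proof. by move=> sp; rewrite -(scale0r 0) sublinear_scale// mul0r. Qed.

Lemma sublinear_opp_le p x : sublinear p -> - p (- x) <= p x.
Proof.
move=> sp; have := sp.1 x (- x).
by rewrite subrr sublinear0//; lra.
Qed.

(** The largest sublinear functional below p whose value at - v is at most
- p v. *)
Definition tilt p v x : R :=
  inf [set p (x + l *: v) - l * p v | l in [set l : R | 0 <= l]].

Section Tilt.
Context {p : E -> R} {v : E}.
Hypothesis sp : sublinear p.

Let tilt_has_lbound x :
  has_lbound [set p (x + l *: v) - l * p v | l in [set l : R | 0 <= l]].
Proof.
exists (- p (- x)) => _ [l /= l0 <-].
have := sp.1 (x + l *: v) (- x).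
by rewrite addrAC subrr add0r sublinear_scale//; lra.
Qed.

Lemma tilt_le_at (l : R) x : 0 <= l -> tilt p v x <= p (x + l *: v) - l * p v.
Proof. by move=> l0; apply: ge_inf => //; exists l. Qed.

Lemma tilt_ge (m : R) x :
  (forall l, 0 <= l -> m <= p (x + l *: v) - l * p v) -> m <= tilt p v x.
Proof.
move=> mP; apply: lb_le_inf; first by exists (p (x + 0 *: v) - 0 * p v), 0 => /=.
by move=> _ [l /= l0 <-]; exact: mP.
Qed.

Lemma tilt_le x : tilt p v x <= p x.
Proof.
by apply: le_trans (tilt_le_at x (lexx 0)) _; rewrite scale0r addr0 mul0r subr0.
Qed.

Lemma tilt_opp : tilt p v (- v) <= - p v.
Proof.
apply: le_trans (tilt_le_at (- v) ler01) _.
by rewrite scale1r addNr sublinear0// mul1r sub0r.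
Qed.

Lemma sublinear_tilt : sublinear (tilt p v).
Proof.
split=> [x y|a x a0].
  rewrite -lerBlDr; apply: tilt_ge => l l0; rewrite lerBlDr -lerBlDl.
  apply: tilt_ge => m m0; rewrite lerBlDl.
  apply: le_trans (tilt_le_at (x + y) (addr_ge0 l0 m0)) _.
  have := sp.1 (x + l *: v) (y + m *: v).
  by rewrite scalerDl addrACA; lra.
have [->|a_neq0] := eqVneq a 0.
  by rewrite scale0r mul0r -(sublinear0 sp) tilt_le.
have a_gt0 : 0 < a by rewrite lt_def a_neq0.
rewrite mulrC -ler_pdivrMr//; apply: tilt_ge => l l0; rewrite ler_pdivrMr//.
apply: le_trans (tilt_le_at (a *: x) (mulr_ge0 a0 l0)) _.
by rewrite -scalerA -scalerDr sublinear_scale//; lra.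
Qed.

End Tilt.

(** The infimum of a chain is sublinear because, of any two members of the
chain, the smaller one bounds the infimum at x + y by the sum of both values.
It is finite since p x >= - p (- x) for each sublinear p. *)
Lemma sublinear_inf (A : set (E -> R)) p0 : A p0 ->
  (forall p, A p -> sublinear p) ->
  (forall p q, A p -> A q -> (forall x, p x <= q x) \/ (forall x, q x <= p x)) ->
  sublinear (fun x => inf [set p x | p in A]) /\
  (forall p x, A p -> inf [set p x | p in A] <= p x).
Proof.
move=> Ap0 As Atot.
have lb x : has_lbound [set p x | p in A].
  (* If p <= p0, bound p x below by - p (- x); otherwise by p0 x. *)
  exists (- p0 (- x)) => _ [p Ap <-].
  have := sublinear_opp_le x (As _ Ap0); have := sublinear_opp_le x (As _ Ap).
  by have [/(_ (- x))|/(_ x)] := Atot _ _ Ap Ap0; lra.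
have inf_le p x : A p -> inf [set p x | p in A] <= p x.
  by move=> Ap; apply: ge_inf => //; exists p.
have le_infA (m : R) x : (forall p, A p -> m <= p x) -> m <= inf [set p x | p in A].
  move=> mP; apply: lb_le_inf; first by exists (p0 x), p0.
  by move=> _ [p Ap <-]; exact: mP.
split=> //; split=> [x y|a x a0].
  rewrite -lerBlDr; apply/le_infA => p Ap; rewrite lerBlDr -lerBlDl.
  apply/le_infA => q Aq; rewrite lerBlDl.
  have [pq|qp] := Atot _ _ Ap Aq.
    apply: le_trans (inf_le _ _ Ap) _.
    by have := (As _ Ap).1 x y; have := pq y; lra.
  apply: le_trans (inf_le _ _ Aq) _.
  by have := (As _ Aq).1 x y; have := qp x; lra.
have [->|a_neq0] := eqVneq a 0.
  rewrite scale0r mul0r -(sublinear0 (As _ Ap0)).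
  exact: inf_le.
have a_gt0 : 0 < a by rewrite lt_def a_neq0.
rewrite mulrC -ler_pdivrMr//; apply/le_infA => p Ap; rewrite ler_pdivrMr//.
by apply: le_trans (inf_le _ _ Ap) _; rewrite (sublinear_scale _ (As _ Ap))// mulrC.
Qed.

Lemma minimal_sublinear p0 : sublinear p0 -> exists p, [/\ sublinear p,
  forall x, p x <= p0 x &
  forall q, sublinear q -> (forall x, q x <= p x) -> q = p].
Proof.
move=> sp0.
pose T := {p : E -> R | sublinear p /\ forall x, p x <= p0 x}.
pose below (s t : T) := `[< forall x, sval t x <= sval s x >].
have [||||t tmin] := @Zorn T below.
- by move=> t; apply/asboolP.
- move=> r s t /asboolP rs /asboolP st; apply/asboolP => x.
  exact: le_trans (st x) (rs x).
- move=> [s sP] [t tP] /asboolP/= st /asboolP/= ts; apply: eq_exist.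
  by apply/funext => x; apply/le_anti; rewrite st ts.
- move=> A Atot; have [[t0 At0]|A0] := pselect (A !=set0); last first.
    by exists (exist _ p0 (conj sp0 (fun x => lexx _))) => s As; case: A0; exists s.
  have [|||si ile] := @sublinear_inf [set sval t | t in A] (sval t0).
  + by exists t0.
  + by move=> _ [t At <-]; exact: (svalP t).1.
  + move=> _ _ [s As <-] [t At <-].
    by have [/asboolP|/asboolP] := Atot _ _ As At; [right|left].
  have ile0 x : inf [set p x | p in [set sval t | t in A]] <= p0 x.
    by apply: le_trans (ile (sval t0) x _) ((svalP t0).2 x); exists t0.
  have t1P := conj si ile0; exists (exist _ _ t1P : T) => s As; apply/asboolP => x /=.
  by apply: ile; exists s.
- case: t tmin => p [sp pp0] tmin; exists p; split=> // q sq qp.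
  have qp0 x : q x <= p0 x := le_trans (qp x) (pp0 x).
  have /= := tmin (exist _ q (conj sq qp0)).
  by move=> /(_ (asboolT qp)) [].
Qed.

(** By minimality a tilt of p equals p, and tilting along x forces
p (- x) <= - p x; an odd sublinear functional is linear. *)
Lemma minimal_sublinear_linear p : sublinear p ->
  (forall q, sublinear q -> (forall x, q x <= p x) -> q = p) ->
  linear (p : E -> R^o).
Proof.
move=> sp pmin.
have pN x : p (- x) = - p x.
  have tp : tilt p x = p.
    by apply: pmin; [exact: sublinear_tilt | exact: tilt_le].
  have := tilt_opp (v := x) sp; rewrite tp.
  by have := sublinear_opp_le x sp; lra.
have pD x y : p (x + y) = p x + p y.
  have := sp.1 x y; have := sp.1 (- x) (- y).
  by rewrite -opprD !pN; lra.
have pZ a x : p (a *: x) = a * p x.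
  have [a0|a0] := leP 0 a; first exact: sublinear_scale.
  rewrite -[a]opprK scaleNr pN sublinear_scale ?mulNr//.
  by rewrite oppr_ge0 ltW.
by move=> a x y; rewrite pD pZ.
Qed.

End Sublinear.

Section DualSpace.
Context {R : realType} {E : normedModType R}.

Lemma dual_of_bounded_linear (p : E -> R^o) (M : R) :
  linear p -> 0 <= M -> (forall x, `|p x| <= M * `|x|) ->
  exists2 f : dual E, f =1 p & `|f| <= M.
Proof.
move=> pl M0 pM.
pose l : {linear E -> R^o} := HB.pack p (GRing.isLinear.Build R E R^o *:%R p pl).
have pc : continuous p.
  apply: (@bounded_linear_continuous R _ _ l); apply/linear_boundedP.
  near=> r => x; apply: le_trans (pM x) _.
  by apply: ler_wpM2r => //; near: r; apply: nbhs_pinfty_ge; rewrite num_real.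
have pP : p \in @continuous_linear R E by rewrite inE.
exists (Dual pP) => //; rewrite dual_normE; apply: dual_norm_le => x x1.
by apply: le_trans (pM x) _; rewrite ler_piMr.
Unshelve. all: by end_near. Qed.

(** A minimal sublinear functional below the norm tilted along s takes at - s
a value at most - |s|, while staying below the norm everywhere. *)
Lemma norming_functional (s : E) : exists2 f : dual E, `|f| <= 1 & f s = `|s|.
Proof.
have sn : sublinear (fun x : E => `|x|).
  by split=> [x y|a x a0]; [exact: ler_normD | rewrite normrZ ger0_norm].
have [p [sp pn pmin]] := minimal_sublinear (sublinear_tilt (v := s) sn).
have pl := minimal_sublinear_linear sp pmin.
have p_le x : p x <= `|x| := le_trans (pn x) (tilt_le (v := s) sn x).
have pN x : p (- x) = - p x.
  by have := pl (-1) x 0; rewrite addr0 scaleN1r (sublinear0 sp) addr0 scaleN1r.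
have [|f fp f1] := dual_of_bounded_linear pl ler01 => //.
  move=> x; rewrite mul1r ler_norml p_le andbT lerNl -pN.
  by apply: le_trans (p_le _) _; rewrite normrN.
exists f => //; rewrite fp.
have := pn (- s); have := tilt_opp (v := s) sn; have := p_le s; rewrite pN; lra.
Qed.

Lemma pairing_bound (f : dual E) x : `|f x| <= `|f| * `|x|.
Proof. exact: dual_norm_bound. Qed.

Lemma bidual_embedding_norm (x : E) : `|bidual_embedding x| = `|x|.
Proof.
apply/eqP; rewrite eq_le; apply/andP; split.
  rewrite [leLHS]dual_normE; apply: dual_norm_le => f f1.
  by apply: le_trans (pairing_bound f x) _; rewrite ler_piMl.
have [f f1 fx] := norming_functional x.
have : `|bidual_embedding x f| <= `|bidual_embedding x| * `|f| := dual_norm_bound _ f.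
rewrite /= /pairing fx normr_id => /le_trans; apply.
by rewrite ler_piMr.
Qed.

End DualSpace.

(** * Limits along an ultrafilter *)

Section UltraLimits.
Context {R : realType} {T : Type} {U : set_system T} {UU : UltraFilter U}.

(** Compactness of [-M, M]: an ultrafilter selects a limit of every bounded
real function at once, which is what makes these limits linear in the function
and hence usable to define functionals. *)
Lemma ultra_bounded_cvg (g : T -> R) (M : R) :
  (\forall t \near U, `|g t| <= M) -> exists l : R, g t @[t --> U] --> l.
Proof.
move=> gM.
(* The image of U is an ultrafilter: an ultrafilter refining it contains no set
   whose preimage is missing from U. *)
have ug : UltraFilter (g @ U).
  have [V [VU gV]] := ultraFilterLemma (fmap_proper_filter g (@ultra_proper _ _ UU)).
  have -> // : g @ U = V.
  apply/seteqP; split=> // A VA.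
  have [//|UnA] := in_ultra_setVsetC (g @^-1` A) UU.
  have : V set0 by rewrite -(setICr A); apply: filterI => //; exact: gV.
  by move=> /filter_not_empty.
have := @segment_compact R (- M) M; rewrite compact_ultra => /(_ _ ug) [].
  by apply: filterS gM => t; rewrite /= in_itv/= ler_norml.
by move=> l [_ gl]; exists l.
Qed.

(** The Banach-Alaoglu theorem along an ultrafilter: the pointwise limits of
uniformly bounded functionals form a bounded functional. *)
Lemma weak_star_ultralimit {E : normedModType R} (u : T -> dual E) (M : R) :
  (\forall t \near U, `|u t| <= M) ->
  exists f : dual E, forall x, u t x @[t --> U] --> (f x : R).
Proof.
move=> uM.
have M0 : 0 <= M.
  by have [t] := filter_ex uM; apply: le_trans.
have uxM x : \forall t \near U, `|u t x| <= M * `|x|.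
  apply: filterS uM => t utM; apply: le_trans (pairing_bound _ _) _.
  by rewrite ler_wpM2r.
have /choice[p pP] x : exists l : R, u t x @[t --> U] --> l.
  exact: ultra_bounded_cvg (uxM x).
have pl : linear (p : E -> R^o).
  move=> a x y.
  apply: (cvg_unique (@Rhausdorff R) (pP (a *: x + y))) => /=.
  under eq_fun do rewrite linearP.
  by apply: cvgD; [apply: cvgZl_tmp; exact: pP | exact: pP].
have [|f fp _] := dual_of_bounded_linear pl M0 => //.
  move=> x; apply: cvgr_to_le (uxM x); exact: cvg_norm.
by exists f => x; rewrite fp.
Qed.

Lemma weak_star_lsc {E : normedModType R} (u : T -> dual E) (f : dual E) (m : R) :
  `|u t| @[t --> U] --> m -> (forall x, u t x @[t --> U] --> (f x : R)) ->
  `|f| <= m.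
Proof.
move=> um uf; rewrite dual_normE; apply: dual_norm_le => x x1.
rewrite -subr_ge0; apply: cvgr_to_ge (cvgB um (cvg_norm (uf x))) _.
near=> t; rewrite subr_ge0.
by apply: le_trans (pairing_bound _ _) _; rewrite ler_piMr.
Unshelve. all: by end_near. Qed.

(** Reflexivity turns the pointwise limit in the bidual into a point of E. *)
Lemma weak_ultralimit {E : normedModType R} (s : T -> E) (M : R) :
  reflexive_space E -> (\forall t \near U, `|s t| <= M) ->
  exists x, forall f : dual E, f (s t) @[t --> U] --> (f x : R).
Proof.
move=> refl sM.
have [|F sF] := @weak_star_ultralimit _ (fun t => bidual_embedding (s t)) M.
  by apply: filterS sM => t; rewrite bidual_embedding_norm.
have : range (@bidual_embedding R E) F by rewrite refl.
by move=> [x _ xF]; exists x => f; have := sF f; rewrite -xF.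
Qed.

(** The case of the bidual, where E embeds isometrically. *)
Lemma weak_lsc {E : normedModType R} (s : T -> E) (x : E) (m : R) :
  `|s t| @[t --> U] --> m ->
  (forall f : dual E, f (s t) @[t --> U] --> (f x : R)) -> `|x| <= m.
Proof.
move=> sm sx; rewrite -bidual_embedding_norm.
apply: (weak_star_lsc (u := fun t => bidual_embedding (s t))) => //.
by under eq_fun do rewrite bidual_embedding_norm.
Qed.

End UltraLimits.

(** * Quasidense monotone multifunctions *)

Section Quasidense.
Context {R : realType} {E : normedModType R}.
Implicit Types (S : multifunction E) (x u : E) (f w : dual E).

Definition gap u w : R :=
  2^-1 * `|u| ^+ 2 + 2^-1 * `|w| ^+ 2 + pairing u w.

Lemma pairing_ge u w : - (`|u| * `|w|) <= pairing u w.
Proof.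
by have := pairing_bound w u; rewrite ler_norml mulrC => /andP[].
Qed.

Lemma gap_ge0 u w : 0 <= gap u w.
Proof.
by rewrite /gap; have := pairing_ge u w; have := sqr_ge0 (`|u| - `|w|); nra.
Qed.

Lemma duality_map_gap u w : duality_map E u (- w) <-> gap u w = 0.
Proof.
rewrite /duality_map /mkset /gap normrN.
have -> : pairing u (- w) = - pairing u w by [].
by split; lra.
Qed.

Lemma pairingB u1 u2 w1 w2 : pairing (u1 - u2) (w1 - w2) =
  pairing u1 w1 - pairing u1 w2 - pairing u2 w1 + pairing u2 w2.
Proof.
have -> : pairing (u1 - u2) (w1 - w2) =
    pairing (u1 - u2) w1 - pairing (u1 - u2) w2 by [].
have pB w : pairing (u1 - u2) w = pairing u1 w - pairing u2 w by exact: linearB.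
by rewrite !pB; ring.
Qed.

Lemma pairingNN u w : pairing (- u) (- w) = pairing u w.
Proof.
have -> : pairing (- u) (- w) = - pairing (- u) w by [].
have -> : pairing (- u) w = - pairing u w by exact: linearN.
exact: opprK.
Qed.

Lemma quasidense_near S x f (e : R) : quasidense S -> 0 < e ->
  exists2 p, graph S p & gap (p.1 - x) (p.2 - f) < e.
Proof.
move=> Sq e0.
have /(le_lt_trans (Sq x f))/ereal_inf_lt[_ [p Sp <-] pe] : (0 < e%:E)%E.
  by rewrite lte_fin.
by exists p => //; rewrite -lte_fin.
Qed.

Lemma quasidense_of_surjective S :
  (forall x, surjective_multi (add_multi (translate x S) (duality_map E))) ->
  quasidense S.
Proof.
move=> Ssurj x f.
have : (\bigcup_(t in [set: E]) add_multi (translate x S) (duality_map E) t) f.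
  by rewrite Ssurj.
move=> [t _ [s Ss [j Jj sj]]].
apply: ge_ereal_inf; exists (gap t (- j))%:E; last first.
  by rewrite lee_fin; have /duality_map_gap -> : duality_map E t (- - j); rewrite ?opprK.
exists (t + x, s) => //=.
have sf : s - f = - j by rewrite -sj opprD addrA subrr sub0r.
by rewrite -sf /gap addrK.
Qed.

(** The pairing being nonnegative, a small gap forces both distances to be
small: (x, f) adheres to the graph. *)
Lemma quasidense_maximal S x f : closed_multi S -> quasidense S ->
  (forall p, graph S p -> 0 <= pairing (p.1 - x) (p.2 - f)) -> S x f.
Proof.
move=> Scl Sq mono.
suff : closure (graph S) (x, f) by move/Scl.
move=> B /nbhs_ballP[e /= e0 eB].
have [|p Sp pe] := @quasidense_near S x f (2^-1 * e ^+ 2) Sq.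
  by rewrite mulr_gt0// exprn_gt0.
have pxf := mono p Sp.
have near_e (r : R) : 0 <= r -> r ^+ 2 < e ^+ 2 -> r < e.
  by move=> r0; rewrite ltr_pXn2r// nnegrE ltW.
exists p; split=> //; apply: eB; split=> /=; rewrite -ball_normE /= distrC.
  apply: near_e => //; have := sqr_ge0 `|p.2 - f|; move: pe; rewrite /gap; lra.
apply: near_e => //; have := sqr_ge0 `|p.1 - x|; move: pe; rewrite /gap; lra.
Qed.

(** Monotonicity bounds - <u, w> by an expression of first degree in the norms
of u and w, which the half squared norms in the gap dominate. *)
Lemma almost_minimizer_bounded u w a b :
  0 <= pairing (u - a) (w - b) -> gap u w <= 1 ->
  `|u| ^+ 2 + `|w| ^+ 2 <= 4 * (1 + `|a| ^+ 2 + `|b| ^+ 2 + `|a| * `|b|).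
Proof.
rewrite /gap pairingB.
have := pairing_bound b u; have := pairing_bound w a.
rewrite !ler_norml => /andP[+ _] /andP[+ _].
have := pairing_bound b a; rewrite ler_norml => /andP[_ +].
rewrite /pairing.
(* These squares bound |u| |b| by |u|^2 / 4 + |b|^2, and |w| |a| likewise. *)
have := sqr_ge0 (`|u| - 2 * `|b|); have := sqr_ge0 (`|w| - 2 * `|a|).
nra.
Qed.

(** The point is a weak limit of almost minimizers.  Such a limit need not adhere
to the graph in norm, so closedness alone cannot place it there; maximality
does. *)
Lemma quasidense_gap0 S x f : reflexive_space E -> closed_multi S ->
  monotone_multi S -> quasidense S ->
  exists2 p, graph S p & gap (p.1 - x) (p.2 - f) = 0.
Proof.
move=> refl Scl Smono Sq.
pose G (e : R) := [set p | graph S p /\ gap (p.1 - x) (p.2 - f) < e].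
have FF : ProperFilter (filter_from [set e : R | 0 < e] G).
  apply: filter_from_proper; last first.
    by move=> e /= /(quasidense_near x f Sq)[p Sp pe]; exists p.
  apply: filter_from_filter; first by exists 1 => /=.
  move=> d e /= d0 e0; exists (Num.min d e); first by rewrite /= lt_min d0.
  by move=> p /= [Sp]; rewrite lt_min => /andP[pd pe].
have [U [UU FU]] := ultraFilterLemma FF.
pose u (p : E * dual E) := p.1 - x; pose w (p : E * dual E) := p.2 - f.
have UG e : 0 < e -> U (G e) by move=> e0; apply: FU; exists e.
have gap_cvg0 : gap (u p) (w p) @[p --> U] --> (0 : R).
  apply/cvgrPdist_lt => e e0; apply: filterS (UG _ e0) => p [_ pe].
  by rewrite sub0r normrN ger0_norm// gap_ge0.
have mono p q : graph S p -> graph S q ->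
    0 <= pairing (u p - u q) (w p - w q).
  have up : u p - u q = p.1 - q.1 by rewrite /u opprB subrKA.
  have wp : w p - w q = p.2 - q.2 by rewrite /w opprB subrKA.
  by rewrite up wp; exact: Smono.
have [q0 Sq0 _] := quasidense_near x f Sq ltr01.
pose C := 4 * (1 + `|u q0| ^+ 2 + `|w q0| ^+ 2 + `|u q0| * `|w q0|).
have C1 : 1 <= C.
  rewrite /C; have := sqr_ge0 `|u q0|; have := sqr_ge0 `|w q0|.
  by have := mulr_ge0 (normr_ge0 (u q0)) (normr_ge0 (w q0)); lra.
have uwC : \forall p \near U, `|u p| <= C /\ `|w p| <= C.
  apply: filterS (UG _ ltr01) => p [Sp /ltW pe].
  have /(_ pe) := almost_minimizer_bounded (mono p q0 Sp Sq0).
  by rewrite -/C => uw; split; nra.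
have uC : \forall p \near U, `|u p| <= C by apply: filterS uwC => p [].
have wC : \forall p \near U, `|w p| <= C by apply: filterS uwC => p [].
have [a ua] := weak_ultralimit refl uC.
have [b wb] := weak_star_ultralimit wC.
have [|alpha u_alpha] := @ultra_bounded_cvg R _ _ _ (fun p => `|u p|) C.
  by apply: filterS uC => p; rewrite normr_id.
have [|beta w_beta] := @ultra_bounded_cvg R _ _ _ (fun p => `|w p|) C.
  by apply: filterS wC => p; rewrite normr_id.
pose h := 2^-1 * alpha ^+ 2 + 2^-1 * beta ^+ 2.
have h_cvg : 2^-1 * `|u p| ^+ 2 + 2^-1 * `|w p| ^+ 2 @[p --> U] --> h.
  by apply: cvgD; apply: cvgMr; rewrite expr2;
    under eq_fun do rewrite expr2; exact: cvgM.
(* The gaps tend to 0, which determines the limit of the pairings. *)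
have pairing_cvg : pairing (u p) (w p) @[p --> U] --> - h.
  rewrite -sub0r; under eq_fun => p.
    rewrite (_ : pairing _ _ = gap (u p) (w p) -
      (2^-1 * `|u p| ^+ 2 + 2^-1 * `|w p| ^+ 2)); last by rewrite /gap; ring.
    over.
  exact: cvgB.
have ab_h : 2^-1 * `|a| ^+ 2 + 2^-1 * `|b| ^+ 2 <= h.
  have le_sqr (r t : R) : 0 <= r -> r <= t -> r ^+ 2 <= t ^+ 2.
    by move=> r0 rt; rewrite !expr2 ler_pM.
  have le_a : `|a| <= alpha by exact: weak_lsc u_alpha ua.
  have le_b : `|b| <= beta by exact: weak_star_lsc w_beta wb.
  have := le_sqr _ _ (normr_ge0 a) le_a.
  have := le_sqr _ _ (normr_ge0 b) le_b.
  by rewrite /h; lra.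
have ab_mono q : graph S q ->
    gap a b <= pairing (a - u q) (b - w q).
  move=> Sq'.
  have : 0 <= - h - pairing a (w q) - pairing (u q) b + pairing (u q) (w q).
    have cvg_mono : pairing (u p - u q) (w p - w q) @[p --> U] -->
        - h - pairing a (w q) - pairing (u q) b + pairing (u q) (w q).
      under eq_fun do rewrite pairingB.
      apply: cvgD; last exact: cvg_cst.
      by apply: cvgB; [apply: cvgB => //; exact: ua | exact: wb].
    apply: cvgr_to_ge cvg_mono _.
    by apply: filterS (UG _ ltr01) => p [Sp _]; exact: mono.
  by rewrite /gap pairingB; lra.
have Sab : graph S (a + x, b + f).
  apply: quasidense_maximal => // q /ab_mono ab_le.
  have -> : q.1 - (a + x) = - (a - u q) by rewrite /u opprB opprD addrA addrAC.
  have -> : q.2 - (b + f) = - (b - w q) by rewrite /w opprB opprD addrA addrAC.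
  by rewrite pairingNN (le_trans (gap_ge0 a b)).
exists (a + x, b + f) => //=; rewrite !addrK.
apply/le_anti; rewrite gap_ge0 andbT.
have := ab_mono _ Sab.
have -> : a - u (a + x, b + f) = 0 by rewrite /u addrK subrr.
have -> : b - w (a + x, b + f) = 0 by rewrite /w addrK subrr.
by have -> : pairing (0 : E) 0 = 0 by [].
Qed.

End Quasidense.

Theorem theorem7p1 (R : realType) (E : completeNormedModType R)
    (E_nonzero : exists x : E, x != 0) (E_reflexive : reflexive_space E)
    (S : multifunction E) (S_closed : closed_multi S)
    (S_monotone : monotone_multi S) (S_nonempty : graph S !=set0) :
  quasidense S <->
  (forall x : E, surjective_multi (add_multi (translate x S) (duality_map E))).
Proof.
split=> [Sq x|]; last exact: quasidense_of_surjective.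
apply/seteqP; split=> // f _.
have [[s g] Ssg gap0] := quasidense_gap0 x f E_reflexive S_closed S_monotone Sq.
exists (s - x) => //; exists g; first by rewrite /translate subrK.
exists (- (g - f)); first exact/duality_map_gap.
by rewrite opprB addrC subrK.
Qed.
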